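(* Let $T_K=T(\boldsymbol A_K,a_K)$ with $T$ differentiable on $\operatorname{SPD}(d)\times(0,\infty)$. In a $\boldsymbol\xi$-variation keep $E_K$, $\boldsymbol M_K$ and the frozen scalar data fixed. With $\boldsymbol T_{A,K}=\partial T_K/\partial\boldsymbol A_K$ and $T_{a,K}=\partial T_K/\partial a_K$, define $$\boldsymbol Q_K:=\boldsymbol A_K\boldsymbol T_{A,K}+a_KT_{a,K}\boldsymbol I,\qquad \boldsymbol U_K:=\boldsymbol J_K\Bigl(-\tfrac12T_K\boldsymbol I+\boldsymbol Q_K\Bigr)\boldsymbol J_K^{-1}.$$ Then the row-stacked local $\boldsymbol\xi$-gradient is $$\mathcal G_K^{\xi}=\frac{\partial G_K}{\partial[\boldsymbol\xi_0^K,\boldsymbol\xi_1^K,\ldots,\boldsymbol\xi_d^K]}=2\rho_K\boldsymbol R\,\widehat E_K^{-1}\boldsymbol Q_K .$$ For the physical-coordinate representation, which differentiates the complete contribution $|K|G_K$, let $$\boldsymbol V_K:=\boldsymbol RE_K^{-1}=\begin{bmatrix}(\nabla\phi_{0,K})^T\\ \vdots\\ (\nabla\phi_{d,K})^T\end{bmatrix},\qquad \boldsymbol e_{d+1}:=(1,\ldots,1)^T\in\mathbb R^{d+1}.$$ Then $$\mathcal G_K^x=-2\rho_K\boldsymbol V_K\boldsymbol U_K+\frac1{d+1}\boldsymbol e_{d+1}\begin{bmatrix}\operatorname{tr}\Bigl(\frac{\partial G_K}{\partial\boldsymbol M_K}\boldsymbol M_{0,K}\Bigr)&\cdots&\operatorname{tr}\Bigl(\frac{\partial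 G_K}{\partial\boldsymbol M_K}\boldsymbol M_{d,K}\Bigr)\end{bmatrix}\boldsymbol V_K .$$ Hence the local descent vectors $\boldsymbol v_j^K=-\frac1{|K|}\frac{\partial(|K|G_K)}{\partial\boldsymbol x_j^K}$, $j=0,\dots,d$, are the (transposed) rows of $-\mathcal G_K^x$. The two kernels are assembled globally (derivatives written as row vectors) as $$\frac{\partial I_h}{\partial\boldsymbol\xi_i}=\sum_{K\in S_i}|K|\,(\mathcal G_K^\xi)_{\ell(i,K),:},\qquad \frac{\partial I_h}{\partial\boldsymbol x_i}=\sum_{K\in S_i}|K|\,(\mathcal G_K^x)_{\ell(i,K),:}.$$
   Context: Let $d\ge2$ and let $\mathcal T_h$ be a simplicial physical mesh with vertices $\boldsymbol x_i$ and a corresponding computational simplicial mesh with vertices $\boldsymbol\xi_i$ (paired positively oriented nondegenerate elements). For an element $K$ with vertices $\boldsymbol x_0^K,\dots,\boldsymbol x_d^K\in\mathbb R^d$ and computational vertices $\boldsymbol\xi_0^K,\dots,\boldsymbol\xi_d^K\in\mathbb R^d$, set $E_K=[\boldsymbol x_1^K-\boldsymbol x_0^K,\ldots,\boldsymbol x_d^K-\boldsymbol x_0^K]$, $\widehat E_K=[\boldsymbol\xi_1^K-\boldsymbol\xi_0^K,\ldots,\boldsymbol\xi_d^K-\boldsymbol\xi_0^K]$, $\boldsymbol J_K=E_K\widehat E_K^{-1}$, $\boldsymbol P_K=\boldsymbol J_K^{-1}$, $\delta_K=\det\boldsymbol P_K>0$; $|K|$ is the volume of the physical element; $\phi_{j,K}$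 is the affine barycentric basis function on $K$ with $\phi_{j,K}(\boldsymbol x_l^K)=\delta_{jl}$. $S_i$ is the set of elements containing node $i$, and $\ell(i,K)\in\{0,\dots,d\}$ is the local index of node $i$ in $K$. Metric: $\boldsymbol M_{j,K}=\boldsymbol M_h(\boldsymbol x_j^K)$ are symmetric positive-definite nodal samples, $\boldsymbol M_h|_K=\sum_{j=0}^d\phi_{j,K}\boldsymbol M_{j,K}$, $\boldsymbol M_K=\frac1{d+1}\sum_{j=0}^d\boldsymbol M_{j,K}$, $\rho_K=\sqrt{\det\boldsymbol M_K}$. Set $\boldsymbol A_K=\boldsymbol P_K\boldsymbol M_K^{-1}\boldsymbol P_K^T$, $a_K=\det\boldsymbol A_K=\det(\boldsymbol M_K^{-1})\delta_K^2$, $T_K=T(\boldsymbol A_K,a_K)$ where $T$ is a function of two independent arguments (any further scalar parameters in $T$, such as a scale $\theta_h$, are frozen), $G_K=\rho_KT_K$, and $I_h=\sum_{K\in\mathcal T_h}|K|G_K$. Conventions: matrix derivatives $\partial T_K/\partial\boldsymbol A_K$ and $\partial G_K/\partial\boldsymbol M_K$ are symmetric-Frobenius derivatives on the space $\operatorname{Sym}(d)$ of symmetric matrices (the symmetric matrix representing the differential via $\langle X,Y\rangle_F=\operatorname{tr}(X^TY)$); $\partial G_K/\partial\boldsymbol M_K$ is taken with $\boldsymbol P_K$ (hence $\delta_K$) fixed and includes the dependence through $\rho_K$, $\boldsymbol A_K$, $a_K$. The row-stacked kernels are $\mathcal G_K^\xi:=\partial G_K/\partial\boldsymbol\Xi_K$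 and $\mathcal G_K^x:=\frac1{|K|}\,\partial(|K|G_K)/\partial\boldsymbol X_K$, where $\boldsymbol\Xi_K,\boldsymbol X_K\in\mathbb R^{(d+1)\times d}$ have rows $(\boldsymbol\xi_j^K)^T$ and $(\boldsymbol x_j^K)^T$, $j=0,\dots,d$; row $j$ is the transpose of the derivative with respect to the $j$-th local vertex. In a $\boldsymbol\xi$-variation the physical mesh (so $|K|$, $E_K$) and metric are fixed. In a $\boldsymbol x$-variation the computational mesh is fixed and the metric is regarded elementwise as the fixed affine field $\boldsymbol M_h|_K$ sampled at the moving vertices, so the variation of $\boldsymbol M_K$ due to $\delta\boldsymbol x_j^K$ is $\frac1{d+1}\sum_{l=0}^d(\nabla\phi_{l,K}\cdot\delta\boldsymbol x_j^K)\boldsymbol M_{l,K}$; there is no other explicit dependence of $G_K$ on $\boldsymbol x$. Finally $\boldsymbol R\in\mathbb R^{(d+1)\times d}$ is the matrix whose first row is $(-1,\dots,-1)$ and whose remaining $d$ rows form the $d\times d$ identity matrix. *)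

(* Defs.v *)
From mathcomp Require Export all_boot all_order all_algebra.
From mathcomp Require Export all_classical all_reals all_analysis.
Export Order.TTheory GRing.Theory Num.Theory.
Export numFieldNormedType.Exports.

Set Implicit Arguments.
Unset Strict Implicit.
Unset Printing Implicit Defensive.

Local Open Scope classical_set_scope.
Local Open Scope ring_scope.

Section Differentiation.
Variable R : realType.

(* Frechet expansion of [f] at [x] along increments in the linear subspace
   [S], with candidate differential [L]. *)
Definition diff_along (V : normedModType R) (S : set V) (f : V -> R) (x : V)
    (L : V -> R) : Prop :=
  forall eps : R, 0 < eps -> \forall h \near within S (nbhs (0 : V)),
    `|f (x + h) - f x - L h| <= eps * `|h|.

Definition Sym (d : nat) : set 'M[R]_d := [set H | H^T = H].

Definition spd (d : nat) (A : 'M[R]_d) : Prop :=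
  A^T = A /\ forall v : 'cV[R]_d, v != 0 -> 0 < (v^T *m A *m v) ord0 ord0.

Definition frob (m n : nat) (X Y : 'M[R]_(m, n)) : R := \tr (X^T *m Y).

Definition is_sym_deriv (d : nat) (f : 'M[R]_d -> R) (A D : 'M[R]_d) : Prop :=
  Sym D /\ diff_along (@Sym d) f A (frob D).

(* The symmetric matrix representing the differential of [f] at [A] on the
   space of symmetric matrices (0 by default if there is none). *)
Definition sym_deriv (d : nat) (f : 'M[R]_d -> R) (A : 'M[R]_d) : 'M[R]_d :=
  xget 0 [set D | is_sym_deriv f A D].

(* Joint differentiability of [T] on Sym(d) x R; the values of [T A a] for
   non-symmetric [A] are irrelevant. *)
Definition sym_differentiable (d : nat) (T : 'M[R]_d -> R -> R)
    (A : 'M[R]_d) (a : R) : Prop :=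
  exists (DA : 'M[R]_d) (Da : R), Sym DA /\
    diff_along [set p : 'M[R]_d * R | Sym p.1] (fun p => T p.1 p.2) (A, a)
      (fun p => frob DA p.1 + Da * p.2).

Definition grad_mx (m n : nat) (F : 'M[R]_(m, n) -> R) (X : 'M[R]_(m, n)) :
    'M[R]_(m, n) :=
  \matrix_(j, k) 'D_(delta_mx j k) F X.

Definition set_row (m n : nat) (j : 'I_m) (y : 'rV[R]_n) (X : 'M[R]_(m, n)) :
    'M[R]_(m, n) :=
  \matrix_(l, k) if l == j then y ord0 k else X l k.

(* Derivative, as a row vector, with respect to the vertex stored in row [j],
   all other vertices being fixed. *)
Definition vertex_deriv (m n : nat) (F : 'M[R]_(m, n) -> R) (X : 'M[R]_(m, n))
    (j : 'I_m) : 'rV[R]_n :=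
  grad_mx (fun y : 'rV[R]_n => F (set_row j y X)) (row j X).

End Differentiation.

(* A simplex is given by the matrix of its vertices, one vertex per row. *)
Section Element.
Variables (R : realType) (d : nat).
Implicit Types (X Xi : 'M[R]_(d.+1, d)) (P M : 'M[R]_d).

(* Column [k] is the edge vector from vertex 0 to vertex [k + 1]. *)
Definition edge_mx X : 'M[R]_d :=
  \matrix_(i, k) (X (lift ord0 k) i - X ord0 i).

(* Euclidean volume of the simplex. *)
Definition volume X : R := `|\det (edge_mx X)| / (d`!)%:R.

Definition jac X Xi : 'M[R]_d := edge_mx X *m invmx (edge_mx Xi).

Definition pjac X Xi : 'M[R]_d := invmx (jac X Xi).

Definition affine_fun (f : 'rV[R]_d -> R) : Prop :=
  exists (g : 'rV[R]_d) (c : R), forall y, f y = (g *m y^T) ord0 ord0 + c.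

Definition barycentric_basis X (phi : 'I_d.+1 -> 'rV[R]_d -> R) : Prop :=
  forall j, affine_fun (phi j) /\ forall l, phi j (row l X) = (j == l)%:R.

Definition affine_metric (phi : 'I_d.+1 -> 'rV[R]_d -> R)
    (Mv : 'I_d.+1 -> 'M[R]_d) (y : 'rV[R]_d) : 'M[R]_d :=
  \sum_j phi j y *: Mv j.

Definition average (Mv : 'I_d.+1 -> 'M[R]_d) : 'M[R]_d :=
  (d.+1%:R)^-1 *: \sum_j Mv j.

Definition rho M : R := Num.sqrt (\det M).

Definition Amx P M : 'M[R]_d := P *m invmx M *m P^T.

Definition Tval (T : 'M[R]_d -> R -> R) P M : R :=
  T (Amx P M) (\det (Amx P M)).

Definition Gval (T : 'M[R]_d -> R -> R) P M : R := rho M * Tval T P M.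

Definition Qmx (T : 'M[R]_d -> R -> R) P M : 'M[R]_d :=
  let A := Amx P M in
  let a := \det A in
  A *m sym_deriv (fun B => T B a) A + (a * derive1 (T A) a)%:M.

Definition Umx (T : 'M[R]_d -> R -> R) X Xi M : 'M[R]_d :=
  let J := jac X Xi in
  let P := pjac X Xi in
  J *m (- (2^-1 * Tval T P M)%:M + Qmx T P M) *m invmx J.

Definition Rmx : 'M[R]_(d.+1, d) :=
  col_mx (const_mx (- 1) : 'rV[R]_d) 1%:M.

Definition G_of_xi (T : 'M[R]_d -> R -> R) X M Xi : R :=
  Gval T (pjac X Xi) M.

(* |K| G_K as a function of the moving physical vertices [Y]: the metric is
   the field [Mh], independent of [Y], sampled at the rows of [Y]. *)
Definition volG_of_x (T : 'M[R]_d -> R -> R) Xi (Mh : 'rV[R]_d -> 'M[R]_d)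
    (Y : 'M[R]_(d.+1, d)) : R :=
  volume Y * Gval T (pjac Y Xi) (average (fun j => Mh (row j Y))).

Definition kernel_xi (T : 'M[R]_d -> R -> R) X M Xi : 'M[R]_(d.+1, d) :=
  grad_mx (G_of_xi T X M) Xi.

Definition kernel_x (T : 'M[R]_d -> R -> R) Xi (Mh : 'rV[R]_d -> 'M[R]_d) X :
    'M[R]_(d.+1, d) :=
  (volume X)^-1 *: grad_mx (volG_of_x T Xi Mh) X.

End Element.

(* [vtx K j] is the global index of the [j]-th local vertex of element [K];
   the coordinates of the nodes are the rows of an N x d matrix. *)
Section Mesh.
Variables (R : realType) (d N : nat) (Th : finType).
Variable vtx : Th -> 'I_d.+1 -> 'I_N.
Implicit Types x xi : 'M[R]_(N, d).

Definition elt_vertices x (K : Th) : 'M[R]_(d.+1, d) := rowsub (vtx K) x.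

Definition positively_oriented x : Prop :=
  forall K, 0 < \det (edge_mx (elt_vertices x K)).

Definition patch (i : 'I_N) : {set Th} := [set K | i \in codom (vtx K)].

Definition local_index (i : 'I_N) (K : Th) : 'I_d.+1 :=
  odflt ord0 [pick l | vtx K l == i].

(* I_h as a function of the computational vertices, resp. of the physical
   vertices with [Mh K] the fixed metric field of element [K]. *)
Definition Ih_of_xi (T : 'M[R]_d -> R -> R) x (MK : Th -> 'M[R]_d) xi : R :=
  \sum_K volume (elt_vertices x K) *
         G_of_xi T (elt_vertices x K) (MK K) (elt_vertices xi K).

Definition Ih_of_x (T : 'M[R]_d -> R -> R) xi
    (Mh : Th -> 'rV[R]_d -> 'M[R]_d) x : R :=
  \sum_K volG_of_x T (elt_vertices xi K) (Mh K) (elt_vertices x K).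

End Mesh.

Arguments Rmx {R d}.

(* Main.v *)
From HB Require Import structures.
From mathcomp Require Import perm ring lra.
Require Import Defs.

(** Fix an element and write P for its inverse Jacobian, M for the averaged
    metric, A = P M^-1 P^T, a = det A, and Q = A T_A + a T_a I.  Everything
    follows from one differential, that of the density G = rho(M) T(A, a) as a
    function of the pair (P, M) ([is_diff_Gval]):

      dG = 2 rho tr(Q dP P^-1) + <dG/dM, dM>.

    The M-part is the definition of dG/dM.  For the P-part put W = dP P^-1.
    Then dA = W A + (W A)^T, hence da = a tr(A^-1 dA) = 2 a tr W, and as T_A is
    symmetric <T_A, dA> = 2 tr(A T_A W); the two contributions add up to
    2 tr(Q W) ([tr_Qmx]).

    The geometry of the simplex enters through W alone.  The edge matrix of a
    vertex array Y is Y^T R, so its variation along H is H^T R and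
    tr(N H^T R) = <R N, H>: a trace against a variation of edges is read off as
    a gradient with respect to the rows of Y ([tr_edge_mx]).  Moving the
    computational vertices gives W = dEhat Ehat^-1.  Moving the physical
    vertices gives W = - P dE Ehat^-1; there the volume varies by
    |K| tr(E^-1 dE), which accounts for the -T/2 term of U_K, and dM comes from the
    gradients of the barycentric functions, that is from the rows of R E^-1.
    Summation over the elements is the chain rule for the linear map restricting
    a global vertex array to one element: it sends the elementary variation of
    node i to that of its local copy, or to 0 off the patch of i
    ([elt_vertices_delta]).

    T is differentiable only along symmetric increments, while the
    matrices here range over full matrix spaces.  Composing with the
    symmetrization [symp] turns differentiability along the symmetric subspace
    into ordinary differentiability ([diff_along_proj], [is_diff_diff_along]);
    as all the matrices A and M that occur are symmetric, this changes none
    of the functions in question. *)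

Set Implicit Arguments.
Unset Strict Implicit.
Unset Printing Implicit Defensive.
Local Open Scope classical_set_scope.
Local Open Scope ring_scope.

(** * Rules for differentials *)

Section Differentials.
Variable R : realType.
Implicit Types U V W : normedModType R.

Lemma is_diff_ext V W (f g df dg : V -> W) x :
  is_diff x f df -> f =1 g -> df =1 dg -> is_diff x g dg.
Proof. by move=> D /funext <- /funext <-. Qed.

Lemma differentiable_is_diff V W (f : V -> W) x :
  differentiable f x -> is_diff x f ('d f x).
Proof. by move=> D; apply: DiffDef. Qed.

Lemma is_diff_differentiable V W (f df : V -> W) x : is_diff x f df ->
  differentiable f x.
Proof. by case. Qed.

Lemma is_diff_uniq V W (f df dg : V -> W) x :
  is_diff x f df -> is_diff x f dg -> df =1 dg.
Proof. by move=> [_ <-] [_ <-]. Qed.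

Lemma is_diff_expansion V W (f df : V -> W) x : is_diff x f df ->
  forall eps, 0 < eps ->
  \forall h \near (0 : V), `|f (x + h) - f x - df h| <= eps * `|h|.
Proof.
move=> D eps e0; have [Df E] := D.
have /eqaddoP /(_ _ e0) := diff_locally Df.
apply: filterS => h; rewrite E /= !fctE /= addrC.
by rewrite [X in (X - _)]/= addrC opprD addrA [h + x]addrC.
Qed.

(** The differential is only required to be the differential of some [g] at
    some [z]: this is how its linearity and continuity are supplied. *)
Lemma expansion_is_diff V W (f g dg : V -> W) x z : is_diff z g dg ->
  (forall eps, 0 < eps ->
    \forall h \near (0 : V), `|f (x + h) - f x - dg h| <= eps * `|h|) ->
  is_diff x f dg.
Proof.
move=> [Dg <-] H; have cL := diff_continuous Dg.
have E : f \o shift x = cst (f x) + 'd g z +o_ 0 id.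
  apply/eqaddoP => eps e0; apply: filterS (H _ e0) => h.
  by rewrite !fctE /= opprD addrA [h + x]addrC.
have dE := diff_unique cL E.
by split=> //; apply/diff_locallyP; rewrite dE.
Qed.

Lemma is_diff_near V W (f g df : V -> W) x :
  is_diff x f df -> (\forall y \near x, f y = g y) -> is_diff x g df.
Proof.
move=> D H; apply: (expansion_is_diff D) => eps e0.
have H0 := nbhs_singleton H.
have : \forall h \near (0 : V), f (x + h) = g (x + h).
  move: H; rewrite (near_shift 0) subr0; apply: filterS => h /=.
  by rewrite [h + x]addrC.
by move: (is_diff_expansion D e0); apply: filterS2 => h + <-; rewrite -H0.
Qed.

Lemma is_diff_chain U V W (g dg : V -> W) (f df : U -> V) x :
  is_diff x f df -> is_diff (f x) g dg ->
  is_diff x (fun u => g (f u)) (fun h => dg (df h)).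
Proof. exact: is_diff_comp. Qed.

Lemma is_diff_const V W (a : W) (x : V) : is_diff x (fun _ => a) (fun _ => 0).
Proof. exact: is_diff_cst. Qed.

Lemma is_diff_add V W (f g df dg : V -> W) x :
  is_diff x f df -> is_diff x g dg ->
  is_diff x (fun y => f y + g y) (fun h => df h + dg h).
Proof. exact: is_diffD. Qed.

Lemma is_diff_mul V (f g df dg : V -> R) x :
  is_diff x f df -> is_diff x g dg ->
  is_diff x (fun y => f y * g y) (fun h => f x * dg h + g x * df h).
Proof. exact: is_diffM. Qed.

Lemma is_diff_sum V W (I : Type) (s : seq I) (f df : I -> V -> W) x :
  (forall i, is_diff x (f i) (df i)) ->
  is_diff x (fun y => \sum_(i <- s) f i y) (fun h => \sum_(i <- s) df i h).
Proof.
move=> D; elim: s => [|i s IH].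
  by apply: is_diff_ext (is_diff_const 0 x) _ _ => y; rewrite big_nil.
by apply: is_diff_ext (is_diff_add (D i) IH) _ _ => y; rewrite big_cons.
Qed.

Lemma is_diff_scalel V W (k dk : V -> R) (w : W) x :
  is_diff x k dk -> is_diff x (fun y => k y *: w) (fun h => dk h *: w).
Proof.
move=> D; have Dk := @ex_diff _ _ _ _ _ _ _ D; split.
  exact: differentiableZl.
by rewrite diffZl // diff_val.
Qed.

Lemma is_diff_fst V W (p : V * W) : is_diff p fst fst.
Proof.
split; first by apply: linear_differentiable => q; exact: cvg_fst.
by rewrite diff_lin // => q; exact: cvg_fst.
Qed.

Lemma is_diff_snd V W (p : V * W) : is_diff p snd snd.
Proof.
split; first by apply: linear_differentiable => q; exact: cvg_snd.
by rewrite diff_lin // => q; exact: cvg_snd.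
Qed.

Lemma differentiable_prod V (I : Type) (s : seq I) (f : I -> V -> R) x :
  (forall i, differentiable (f i) x) ->
  differentiable (fun y => \prod_(i <- s) f i y) x.
Proof.
move=> D; elim: s => [|i s IH].
  by under eq_fun do rewrite big_nil; apply: differentiable_cst.
under eq_fun do rewrite big_cons; exact: (differentiableM (D i) IH).
Qed.

Lemma differentiable_sqrt (x : R) : 0 < x -> differentiable (@Num.sqrt R) x.
Proof. by move=> x0; apply/derivable1_diffP; have [] := is_derive1_sqrt x0. Qed.

Lemma derive_affine V (f : V -> R) x v c :
  (forall t : R, f (x + t *: v) = f x + t * c) -> 'D_v f x = c.
Proof.
move=> E; apply: lim_near_cst => //; rewrite near_withinE; near=> t => t0.
rewrite /= [t *: v + x]addrC E addrAC subrr add0r -[LHS]/(t^-1 * (t * c)).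
by rewrite mulrA mulVf // mul1r.
Unshelve. all: by end_near. Qed.

End Differentials.

(** * Matrix-valued maps, determinant and inverse *)

Section MatrixCalculus.
Variable R : realType.
Implicit Types U V W : normedModType R.

Lemma is_diff_coord m n (A : 'M[R]_(m, n)) i j :
  is_diff A (fun B : 'M[R]_(m, n) => B i j) (fun H => H i j).
Proof.
have D := @differentiable_coord R m n A i j; split=> //.
apply: funext => H; rewrite -deriveE //.
by apply: derive_affine => t; rewrite !mxE.
Qed.

Lemma is_diff_entry V m n (F dF : V -> 'M[R]_(m, n)) x i j :
  is_diff x F dF -> is_diff x (fun y => F y i j) (fun h => dF h i j).
Proof. by move=> D; apply: is_diff_chain D (is_diff_coord _ i j). Qed.

Lemma is_diff_mx V m n (F dF : V -> 'M[R]_(m, n)) x :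
  (forall i j, is_diff x (fun y => F y i j) (fun h => dF h i j)) ->
  is_diff x F dF.
Proof.
move=> D.
have : is_diff x (fun y => \sum_i \sum_j F y i j *: (delta_mx i j : 'M[R]_(m, n)))
   (fun h => \sum_i \sum_j dF h i j *: (delta_mx i j : 'M[R]_(m, n))).
  by do 2!(apply: is_diff_sum => ?); apply: is_diff_scalel.
by move/is_diff_ext; apply=> y; rewrite -matrix_sum_delta.
Qed.

Lemma differentiable_mx V m n (F : V -> 'M[R]_(m, n)) x :
  (forall i j, differentiable (fun y => F y i j) x) -> differentiable F x.
Proof.
move=> D.
have := @is_diff_mx V m n F (fun h => \matrix_(i, j) 'd (fun y => F y i j) x h) x.
case=> // i j.
by apply: is_diff_ext (differentiable_is_diff (D i j)) _ _ => // h; rewrite mxE.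
Qed.

(** A matrix space is finite dimensional, so no continuity has to be assumed:
    the map is a finite combination of coordinates. *)
Lemma is_diff_linear m n W (L : 'M[R]_(m, n) -> W) A : linear L ->
  is_diff A L L.
Proof.
move=> linL.
pose LM := GRing.isLinear.Build _ _ _ _ _ linL.
pose LL : {linear 'M[R]_(m, n) -> W} := HB.pack L LM.
have E B : L B = \sum_i \sum_j B i j *: L (delta_mx i j).
  rewrite {1}[B]matrix_sum_delta -[L _]/(LL _) linear_sum; apply: eq_bigr => i _.
  by rewrite linear_sum; apply: eq_bigr => j _; rewrite linearZ.
have : is_diff A (fun B => \sum_i \sum_j B i j *: L (delta_mx i j))
   (fun B => \sum_i \sum_j B i j *: L (delta_mx i j)).
  by do 2!(apply: is_diff_sum => ?); apply/is_diff_scalel/is_diff_coord.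
by move/is_diff_ext; apply=> y; rewrite -E.
Qed.

Lemma is_diff_mulmx V m n p (F dF : V -> 'M[R]_(m, n)) (G dG : V -> 'M[R]_(n, p)) x :
  is_diff x F dF -> is_diff x G dG ->
  is_diff x (fun y => F y *m G y) (fun h => dF h *m G x + F x *m dG h).
Proof.
move=> DF DG; apply: is_diff_mx => i j.
have : is_diff x (fun y => \sum_k F y i k * G y k j)
  (fun h => \sum_k (F x i k * dG h k j + G x k j * dF h i k)).
  by apply: is_diff_sum => k; apply: is_diff_mul; apply: is_diff_entry.
move/is_diff_ext; apply => [y|h]; rewrite !mxE // -big_split.
by apply: eq_bigr => k _; rewrite addrC [G x k j * _]mulrC.
Qed.

Lemma is_diff_trmx (V : normedModType R) m n (F dF : V -> 'M[R]_(m, n)) x :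
  is_diff x F dF -> is_diff x (fun y => (F y)^T) (fun h => (dF h)^T).
Proof.
move=> D; apply: is_diff_chain D (is_diff_linear _ _) => a B C.
by rewrite linearP.
Qed.

Lemma diff_delta_sum m n (F : 'M[R]_(m, n) -> R) A H : differentiable F A ->
  'd F A H = \sum_i \sum_j H i j * 'd F A (delta_mx i j).
Proof.
move=> D; rewrite {1}[H]matrix_sum_delta linear_sum; apply: eq_bigr => i _.
by rewrite linear_sum; apply: eq_bigr => j _; rewrite linearZ.
Qed.

Lemma differentiable_det n (A : 'M[R]_n) : differentiable (determinant : 'M[R]_n -> R) A.
Proof.
have D (s : 'S_n) : is_diff A (fun B : 'M[R]_n => (-1) ^+ s * \prod_i B i (s i))
    (fun h => 'd (fun B : 'M[R]_n => (-1) ^+ s * \prod_i B i (s i)) A h).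
  apply: differentiable_is_diff.
  apply: (differentiableM (differentiable_cst _ _)).
  by apply: differentiable_prod => i; apply: differentiable_coord.
by case: (is_diff_sum (index_enum _) D).
Qed.

(** Laplace expansion along row [i], whose cofactors do not see that row. *)
Lemma det_add_delta n (A : 'M[R]_n) i j t :
  \det (A + t *: delta_mx i j) = \det A + t * cofactor A i j.
Proof.
rewrite (expand_det_row _ i) (expand_det_row A i).
have E k : cofactor (A + t *: delta_mx i j) i k = cofactor A i k.
  rewrite /cofactor; congr (_ * \det _); apply/matrixP => a b.
  by rewrite !mxE -!/(lift i a) (eq_sym _ i) (negbTE (neq_lift i a)) /= mulr0 addr0.
under eq_bigr do rewrite E !mxE eqxx /= mulrDl.
rewrite big_split /=; congr (_ + _); rewrite (bigD1 j) //= eqxx mulr1.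
by rewrite big1 ?addr0 // => k /negbTE ->; rewrite mulr0 mul0r.
Qed.

(** By [det_add_delta] the partial derivatives are the cofactors. *)
Lemma is_diff_det n (A : 'M[R]_n) :
  is_diff A determinant (fun H => \tr (\adj A *m H)).
Proof.
have D := differentiable_det A.
apply: is_diff_ext (differentiable_is_diff D) _ _ => // H.
rewrite diff_delta_sum // mxtrace_mulC; apply: eq_bigr => i _.
rewrite mxE; apply: eq_bigr => j _; rewrite -deriveE // mxE.
by congr (_ * _); apply: derive_affine => t; apply: det_add_delta.
Qed.

Lemma unitmx_near n (A : 'M[R]_n) : A \in unitmx ->
  \forall B \near A, B \in unitmx.
Proof.
rewrite unitmxE unitfE => A0.
have /cvgr_neq0 := differentiable_continuous (differentiable_det A).
by move=> /(_ A0); apply: filterS => B; rewrite unitmxE unitfE.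
Qed.

(** Near a unit, Cramer's rule writes the inverse as a rational function. *)
Lemma differentiable_invmx n (A : 'M[R]_n) : A \in unitmx ->
  differentiable invmx A.
Proof.
move=> uA; have A0 : \det A != 0 by rewrite -unitfE -unitmxE.
have D : differentiable (fun B : 'M[R]_n => (\det B)^-1 *: \adj B) A.
  apply: differentiable_mx => i j.
  have -> : (fun B : 'M[R]_n => ((\det B)^-1 *: \adj B) i j) =
     (fun B => (\det B)^-1 * ((-1) ^+ (j + i) * \det (row' j (col' i B)))).
    by apply: funext => B; rewrite !mxE.
  apply: differentiableM; first exact: (differentiableV (differentiable_det A) A0).
  apply: (differentiableM (differentiable_cst _ _)).
  apply: (differentiable_comp _ (differentiable_det _)).
  apply: differentiable_mx => a b; under eq_fun do rewrite !mxE.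
  exact: differentiable_coord.
suff [] : is_diff A invmx ('d (fun B : 'M[R]_n => (\det B)^-1 *: \adj B) A) by [].
apply: (is_diff_near (differentiable_is_diff D)).
by apply: filterS (unitmx_near uA) => B uB; rewrite /invmx uB.
Qed.

(** Differentiate the identity B^-1 B = 1. *)
Lemma is_diff_invmx n (A : 'M[R]_n) : A \in unitmx ->
  is_diff A invmx (fun H => - (invmx A *m H *m invmx A)).
Proof.
move=> uA; have D := differentiable_is_diff (differentiable_invmx uA).
apply: is_diff_ext (D) _ _ => // H.
have D1 := is_diff_mulmx D (is_diff_id A).
have D2 : is_diff A (fun B => invmx B *m B) (fun _ => 0).
  apply: (is_diff_near (is_diff_const 1%:M A)).
  by apply: filterS (unitmx_near uA) => B uB; rewrite mulVmx.
have /= E := is_diff_uniq D1 D2 H.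
rewrite -[LHS](mulmxK uA) -mulNmx; congr (_ *m _).
by apply/eqP; rewrite -addr_eq0 E.
Qed.

Lemma adj_unitE n (A : 'M[R]_n) : A \in unitmx -> \adj A = \det A *: invmx A.
Proof.
move=> uA; rewrite /invmx uA scalerA mulfV ?scale1r //.
by rewrite -unitfE -unitmxE.
Qed.

End MatrixCalculus.

(** * Symmetric positive definite matrices *)

Section PositiveDefinite.
Variable R : realType.

Lemma spd_unitmx d (A : 'M[R]_d) : spd A -> A \in unitmx.
Proof.
(* A vector of the kernel would annihilate the quadratic form. *)
move=> [_ pA]; rewrite -row_free_unit -kermx_eq0; apply: contraT => /rowV0Pn[v].
move=> /sub_kermxP vA v0.
have := pA v^T; rewrite trmxK vA mul0mx mxE ltxx => /(_ _).
by rewrite trmx_eq0 => /(_ v0).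
Qed.

Lemma spd1 d : spd (1%:M : 'M[R]_d).
Proof.
split; first exact: trmx1.
move=> v v0; rewrite mulmx1 mxE lt_def sumr_ge0 ?andbT; last first.
  by move=> i _; rewrite mxE -expr2 sqr_ge0.
apply: contra v0; rewrite psumr_eq0; last by move=> i _; rewrite mxE -expr2 sqr_ge0.
move=> /allP v0; apply/eqP/matrixP => i j; rewrite ord1 mxE.
by have := v0 i (mem_index_enum i); rewrite mxE -expr2 sqrf_eq0 => /eqP.
Qed.

Lemma spd_convex d (A B : 'M[R]_d) s : spd A -> spd B -> 0 <= s <= 1 ->
  spd ((1 - s) *: A + s *: B).
Proof.
move=> [sA pA] [sB pB] /andP[s0 s1]; split; first by rewrite linearD !linearZ /= sA sB.
move=> v v0; rewrite mulmxDr mulmxDl -!scalemxAr -!scalemxAl mxE.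
rewrite [X in X + _]mxE [X in _ + X]mxE.
have a0 := pA _ v0; have b0 := pB _ v0.
have [->|sn0] := eqVneq s 0; first by rewrite subr0 mul1r mul0r addr0.
by rewrite ltr_wpDl ?mulr_ge0 ?subr_ge0 ?mulr_gt0 // ?(ltW a0) // lt_def sn0.
Qed.

(** On the segment from [A] to the identity the determinant is a polynomial
    that has no zero and ends at 1. *)
Lemma spd_det_gt0 d (A : 'M[R]_d) : spd A -> 0 < \det A.
Proof.
move=> sA; rewrite ltNge; apply/negP => A0.
pose p := \det (\matrix_(i, j) ((1 - 'X) * (A i j)%:P + 'X * (i == j)%:R%:P)).
have pE t : p.[t] = \det ((1 - t) *: A + t *: 1%:M).
  rewrite /p -[LHS]/(horner_eval t _) -det_map_mx; congr (\det _).
  apply/matrixP => i j; rewrite !mxE.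
  by rewrite -[LHS]/(horner _ t) !hornerE.
have p1 : 0 <= p.[1] by rewrite pE subrr scale0r add0r scale1r det1 ler01.
have p0 : p.[0] <= 0 by rewrite pE subr0 scale1r scale0r addr0.
have [t t01 /rootP] := poly_ivt ler01 (introT andP (conj p0 p1)).
rewrite pE => /eqP; apply/negP; rewrite -unitfE -unitmxE.
exact/spd_unitmx/spd_convex/t01/spd1.
Qed.

Lemma spd_congr d (A P : 'M[R]_d) : spd A -> P \in unitmx -> spd (P *m A *m P^T).
Proof.
move=> [sA pA] uP; split; first by rewrite !trmx_mul trmxK sA mulmxA.
move=> v v0; have := pA (P^T *m v); rewrite trmx_mul trmxK !mulmxA; apply.
apply: contra v0 => /eqP /(congr1 (mulmx (invmx P^T))).
by rewrite mulKmx ?unitmx_tr // mulmx0 => ->.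
Qed.

Lemma spd_invmx d (A : 'M[R]_d) : spd A -> spd (invmx A).
Proof.
move=> sA; have uA := spd_unitmx sA.
have := spd_congr sA (_ : invmx A \in unitmx).
rewrite unitmx_inv uA => /(_ isT); rewrite mulVmx // mul1mx trmx_inv.
by case: sA => ->.
Qed.

Lemma spd_Amx d (P M : 'M[R]_d) : spd M -> P \in unitmx -> spd (Amx P M).
Proof. by move=> sM; apply/spd_congr/spd_invmx. Qed.

Lemma spd_average d (M : 'I_d.+1 -> 'M[R]_d) : (forall j, spd (M j)) ->
  spd (average M).
Proof.
move=> sM; split.
  rewrite /average linearZ /= linear_sum; congr (_ *: _); apply: eq_bigr => j _.
  by case: (sM j).
move=> v v0; rewrite /average -scalemxAr -scalemxAl mxE mulr_gt0 ?invr_gt0 ?ltr0n //.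
rewrite mulmx_sumr mulmx_suml summxE (bigD1 ord0) //= ltr_pwDl ?sumr_ge0 //.
  by case: (sM ord0) => _; apply.
by move=> i _; case: (sM i) => _ /(_ _ v0) /ltW.
Qed.

End PositiveDefinite.

(** * Frobenius gradients *)

Section Gradients.
Variable R : realType.

Lemma frobE m n (X Y : 'M[R]_(m, n)) : frob X Y = \sum_i \sum_j X i j * Y i j.
Proof.
rewrite /frob /mxtrace exchange_big; apply: eq_bigr => j _.
by rewrite mxE; apply: eq_bigr => i _; rewrite mxE.
Qed.

Lemma frob_linear m n (X : 'M[R]_(m, n)) : linear (frob X).
Proof. by move=> a Y Z; rewrite /frob mulmxDr -scalemxAr linearP. Qed.

Lemma frobZl m n a (B H : 'M[R]_(m, n)) : frob (a *: B) H = a * frob B H.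
Proof. by rewrite /frob linearZ -scalemxAl mxtraceZ. Qed.

Lemma frobDl m n (B C H : 'M[R]_(m, n)) : frob (B + C) H = frob B H + frob C H.
Proof. by rewrite /frob linearD mulmxDl mxtraceD. Qed.

Lemma frobNl m n (B H : 'M[R]_(m, n)) : frob (- B) H = - frob B H.
Proof. by rewrite -scaleN1r frobZl mulN1r. Qed.

Lemma frob_delta m n (X : 'M[R]_(m, n)) i j : frob X (delta_mx i j) = X i j.
Proof.
rewrite frobE (bigD1 i) //= (bigD1 j) //= mxE !eqxx mulr1 !big1 ?addr0 //.
  by move=> k /negbTE ik; rewrite big1 // => l _; rewrite mxE ik mulr0.
by move=> k /negbTE jk; rewrite mxE jk andbF mulr0.
Qed.

Lemma frob_tr m n (X Y : 'M[R]_(m, n)) : frob X^T Y^T = frob X Y.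
Proof. by rewrite /frob trmxK mxtrace_mulC -mxtrace_tr trmx_mul trmxK. Qed.

Lemma frob_symE n (A H : 'M[R]_n) : A^T = A -> frob A H = \tr (A *m H).
Proof. by rewrite /frob => ->. Qed.

Lemma is_diff_frob m n (F : 'M[R]_(m, n) -> R) X (L : 'M[R]_(m, n) -> R) :
  is_diff X F L -> L =1 frob (\matrix_(i, j) L (delta_mx i j)).
Proof.
move=> [DF <-] H; rewrite diff_delta_sum // frobE; apply: eq_bigr => i _.
by apply: eq_bigr => j _; rewrite mxE mulrC.
Qed.

Lemma grad_mxE m n (F : 'M[R]_(m, n) -> R) X (B : 'M[R]_(m, n)) :
  is_diff X F (frob B) -> grad_mx F X = B.
Proof.
move=> [DF E]; apply/matrixP => i j.
by rewrite mxE deriveE // E frob_delta.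
Qed.

Lemma differentiable_grad m n (F : 'M[R]_(m, n) -> R) X :
  differentiable F X -> is_diff X F (frob (grad_mx F X)).
Proof.
move=> D; have DF := differentiable_is_diff D.
rewrite (_ : grad_mx F X = \matrix_(i, j) 'd F X (delta_mx i j)).
  by apply: is_diff_ext (DF) _ _ => //; apply: is_diff_frob (DF).
by apply/matrixP => i j; rewrite !mxE deriveE.
Qed.

(** Replacing row [j] is an affine map, whose linear part sends the [k]-th
    basis row to the elementary matrix at [(j, k)]. *)
Lemma vertex_derivE m n (F L : 'M[R]_(m, n) -> R) X j : is_diff X F L ->
  vertex_deriv F X j = \row_k L (delta_mx j k).
Proof.
move=> D.
have Ds : is_diff (row j X) (fun y => set_row j y X) (fun h => set_row j h 0).
  apply: is_diff_mx => l k.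
  have [->|lj] := eqVneq l j.
    by apply: is_diff_ext (is_diff_coord (row j X) ord0 k) _ _ => y; rewrite mxE eqxx.
  by apply: is_diff_ext (is_diff_const (X l k) (row j X)) _ _ => y;
    rewrite !mxE (negbTE lj).
have EX : set_row j (row j X) X = X.
  by apply/matrixP => l k; rewrite !mxE; case: eqP => // ->.
have := is_diff_chain (g := F) Ds; rewrite EX => /(_ _ D) Dc.
apply: grad_mxE; apply: is_diff_ext (Dc) _ _ => // h.
rewrite (is_diff_frob Dc) //; congr (frob _ _); apply/matrixP => i k.
rewrite !mxE ord1; congr (L _); apply/matrixP => a b.
by rewrite !mxE; case: (a == j).
Qed.

End Gradients.

(** * Symmetrization *)

Section Symmetrization.
Variable R : realType.
Implicit Types V : normedModType R.

(** A contracting projection [p] onto [S] turns differentiability along [S]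
    into differentiability in all directions: the expansion at [x + p h] has an
    error controlled by [p h], hence by [h]. *)
Lemma diff_along_proj V (S : set V) (p : V -> V) (f L : V -> R) x z :
  (forall h, S (p h)) -> (forall y h, p (y + h) = p y + p h) ->
  (forall h, `|p h| <= `|h|) -> p x = x ->
  is_diff z (fun h => L (p h)) (fun h => L (p h)) ->
  diff_along S f x L -> is_diff x (fun y => f (p y)) (fun h => L (p h)).
Proof.
move=> Sp pD np px DL Df; apply: (expansion_is_diff DL) => eps e0.
have /nbhs_normP[d /= d0 H] := Df eps e0.
apply/nbhs_normP; exists d => //= h /=; rewrite sub0r normrN => hd.
rewrite pD px; apply: le_trans (ler_wpM2l (ltW e0) (np h)).
by apply: H => //=; rewrite sub0r normrN (le_lt_trans (np h)).
Qed.

Lemma is_diff_diff_along V (S : set V) (p : V -> V) (f L : V -> R) x :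
  (forall h, S h -> p (x + h) = x + h) -> p x = x ->
  is_diff x (fun y => f (p y)) L -> diff_along S f x L.
Proof.
move=> ph px D eps e0; rewrite near_withinE.
by apply: filterS (is_diff_expansion D e0) => h + /ph E; rewrite E px.
Qed.

Variable d : nat.
Implicit Types (A B D H : 'M[R]_d).

Definition symp A : 'M[R]_d := 2^-1 *: (A + A^T).

Lemma tr_symp A : (symp A)^T = symp A.
Proof. by rewrite /symp linearZ linearD /= trmxK addrC. Qed.

Lemma symp_id A : A^T = A -> symp A = A.
Proof.
move=> sA; rewrite /symp sA -mulr2n -[A *+ 2]scaler_nat scalerA.
by rewrite mulVf ?scale1r ?pnatr_eq0.
Qed.

Lemma symp_linear : linear symp.
Proof.
move=> a A B; rewrite /symp [(_ + _)^T]linearP /= addrACA -[a *: A + _]scalerDr.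
by rewrite [2^-1 *: (_ *: _ + _)]scalerDr !scalerA [a * _]mulrC.
Qed.

Lemma sympD A B : symp (A + B) = symp A + symp B.
Proof. by rewrite -[A in LHS]scale1r symp_linear scale1r. Qed.

Lemma norm_trmx_le A : `|A^T| <= `|A|.
Proof.
rewrite [leLHS]mx_normrE [leRHS]mx_normrE; apply/bigmax_leP; split.
  by apply/bigmax_geP; left.
move=> [i j] _; apply/bigmax_geP; right; exists (j, i) => //=.
by rewrite mxE.
Qed.

Lemma norm_symp_le A : `|symp A| <= `|A|.
Proof.
rewrite /symp normrZ ger0_norm // ler_pdivrMl // mulrC mulr_natr mulr2n.
by rewrite (le_trans (ler_normD _ _)) // lerD2l norm_trmx_le.
Qed.

Lemma frob_symp D H : D^T = D -> frob D (symp H) = frob D H.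
Proof.
move=> sD; rewrite /symp /frob -scalemxAr mulmxDr linearZ linearD /=.
rewrite -!/(frob _ _) -{2}sD frob_tr; lra.
Qed.

(** The Frobenius gradient of the symmetrized function is itself symmetric,
    because that function does not change under a further symmetrization;
    hence it is the symmetric derivative of [f]. *)
Lemma sym_deriv_is_diff (f : 'M[R]_d -> R) A : A^T = A ->
  differentiable (fun B => f (symp B)) A ->
  is_sym_deriv f A (sym_deriv f A) /\
  is_diff A (fun B => f (symp B)) (frob (sym_deriv f A)).
Proof.
move=> sA D; have DF := differentiable_is_diff D.
suff K : is_sym_deriv f A (sym_deriv f A).
  split=> //; case: K => sD K.
  have : is_diff A (fun B => f (symp B)) (fun H => frob (sym_deriv f A) (symp H)).
    apply: (@diff_along_proj _ (@Sym R d) symp f (frob (sym_deriv f A)) A 0);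
      last exact: K.
    - exact: tr_symp.
    - exact: sympD.
    - exact: norm_symp_le.
    - exact: symp_id.
    apply: is_diff_ext (is_diff_linear _ (frob_linear (sym_deriv f A))) _ _ => H;
      by rewrite frob_symp.
  by move/is_diff_ext; apply=> // H; rewrite frob_symp.
apply: xgetPex; exists (grad_mx (fun B => f (symp B)) A).
have DG := differentiable_grad D; move: (grad_mx _ _) DG => G DG.
split.
  have DGs : is_diff A (fun B => f (symp B)) (fun H => frob G (symp H)).
    have := is_diff_linear A symp_linear => Ds.
    have Dc := is_diff_chain (f := symp) (g := fun B => f (symp B)) Ds.
    rewrite (symp_id sA) in Dc; apply: is_diff_ext (Dc _ DG) _ _ => // B.
    by rewrite (symp_id (tr_symp B)).
  have E := is_diff_uniq DG DGs.
  apply/matrixP => i j; rewrite mxE -(frob_delta G j i) -(frob_delta G i j).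
  rewrite [LHS]E [RHS]E; congr (frob G _).
  by rewrite /symp !trmx_delta addrC.
apply: is_diff_diff_along DG; last exact: symp_id.
by move=> H sH; rewrite symp_id // linearD /= sA sH.
Qed.

(** The joint differential of [T] is expressed by its two partial derivatives,
    each recovered by restricting to one argument. *)
Lemma sym_differentiable_is_diff (T : 'M[R]_d -> R -> R) A a : A^T = A ->
  sym_differentiable T A a ->
  Sym (sym_deriv (fun B => T B a) A) /\
  is_diff (A, a) (fun p => T (symp p.1) p.2)
    (fun p => frob (sym_deriv (fun B => T B a) A) p.1 + derive1 (T A) a * p.2).
Proof.
move=> sA [DA [Da [sDA K]]].
have Dlin z : is_diff z (fun h : 'M[R]_d * R => frob DA h.1 + Da * h.2)
    (fun h => frob DA h.1 + Da * h.2).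
  apply: is_diff_add.
    exact: (is_diff_chain (is_diff_fst z) (is_diff_linear _ (frob_linear _))).
  apply: is_diff_ext (is_diff_mul (is_diff_const Da z) (is_diff_snd z)) _ _ => // h.
  by rewrite mulr0 addr0.
have D : is_diff (A, a) (fun p => T (symp p.1) p.2)
    (fun p => frob DA p.1 + Da * p.2).
  have Dproj := @diff_along_proj _ [set p : 'M[R]_d * R | Sym p.1]
     (fun p => (symp p.1, p.2)) (fun p => T p.1 p.2)
     (fun p => frob DA p.1 + Da * p.2) (A, a) 0.
  have D0 : is_diff (A, a) (fun p => T (symp p.1) p.2)
      (fun p => frob DA (symp p.1) + Da * p.2).
    apply: Dproj => //.
    - by move=> h; apply: tr_symp.
    - by move=> y h; rewrite /= sympD.
    - by move=> [h b]; rewrite !prod_normE /= ge_max !le_max norm_symp_le lexx orbT.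
    - by rewrite symp_id.
    - by apply: is_diff_ext (Dlin 0) _ _ => -[h b] /=; rewrite frob_symp.
  by apply: is_diff_ext D0 _ _ => // -[h b] /=; rewrite frob_symp.
have DA' : is_diff A (fun B => T (symp B) a) (fun H => frob DA H).
  have Dp := is_diff_pair (is_diff_id A) (is_diff_const a A).
  apply: is_diff_ext (is_diff_chain Dp D) _ _ => // H /=.
  by rewrite mulr0 addr0.
have Da' : is_diff a (T A) (fun b => Da * b).
  have Dp := is_diff_pair (is_diff_const A a) (is_diff_id a).
  apply: is_diff_ext (is_diff_chain Dp D) _ _ => b /=; first by rewrite symp_id.
  by rewrite /frob mulmx0 mxtrace0 add0r.
have [[sTA _] DA''] := sym_deriv_is_diff (f := fun B => T B a) sA
  (is_diff_differentiable DA').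
split=> //; apply: is_diff_ext D _ _ => // -[H b] /=; congr (_ + _ * _).
  exact: is_diff_uniq DA' DA'' H.
case: Da' => D1 E1.
by rewrite derive1E deriveE // E1 mulr1.
Qed.

End Symmetrization.

(** * Differential of the energy density *)

Section Density.
Variables (R : realType) (d : nat).
Implicit Types (A P M H W : 'M[R]_d).

Lemma tr_Amx P M : M^T = M -> (Amx P M)^T = Amx P M.
Proof. by move=> sM; rewrite /Amx !trmx_mul trmxK trmx_inv sM mulmxA. Qed.

Lemma is_diff_Amx (V : normedModType R) (F dF G dG : V -> 'M[R]_d) x :
  G x \in unitmx -> is_diff x F dF -> is_diff x G dG ->
  is_diff x (fun y => Amx (F y) (G y)) (fun h =>
    (dF h *m invmx (G x) + F x *m - (invmx (G x) *m dG h *m invmx (G x)))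
       *m (F x)^T + F x *m invmx (G x) *m (dF h)^T).
Proof.
move=> uG DF DG; apply: is_diff_mulmx (is_diff_trmx DF).
by apply: is_diff_mulmx DF _; apply: is_diff_chain DG (is_diff_invmx uG).
Qed.

Variable T : 'M[R]_d -> R -> R.
Hypothesis T_diff : forall A (a : R), spd A -> 0 < a -> sym_differentiable T A a.

Variables (P M : 'M[R]_d).
Hypotheses (uP : P \in unitmx) (sM : spd M).

Let A := Amx P M.
Let Q := Qmx T P M.
Let TA := sym_deriv (fun B => T B (\det A)) A.
Let Ta := derive1 (T A) (\det A).

Let spdA : spd A. Proof. exact: spd_Amx. Qed.
Let symA : A^T = A. Proof. by case: spdA. Qed.
Let uA : A \in unitmx. Proof. exact: spd_unitmx. Qed.

(** The symmetrization lets [B] be any matrix-valued map; for a symmetric [B]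
    the function is T(B, det B). *)
Lemma is_diff_Tval (V : normedModType R) (B dB : V -> 'M[R]_d) x :
  B x = A -> is_diff x B dB ->
  is_diff x (fun y => T (symp (B y)) (\det (B y)))
    (fun h => frob TA (dB h) + Ta * (\det A * \tr (invmx A *m dB h))).
Proof.
move=> BA DB.
have [_ DT] := sym_differentiable_is_diff symA (T_diff spdA (spd_det_gt0 spdA)).
have Dd := is_diff_chain DB (is_diff_det (B x)).
have Dp := is_diff_pair DB Dd.
have Dc := is_diff_chain (g := fun p => T (symp p.1) p.2) Dp.
rewrite /= BA in Dc; apply: is_diff_ext (Dc _ DT) _ _ => // h /=.
by rewrite adj_unitE // -scalemxAl mxtraceZ.
Qed.

(** Each half of [dA] contributes [\tr (A *m TA *m W)] through [TA], by the
    symmetry of [TA], and [\tr W] through the determinant. *)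
Lemma tr_Qmx H (W := H *m invmx P) (dA := W *m A + (W *m A)^T) :
  frob TA dA + Ta * (\det A * \tr (invmx A *m dA)) = 2 * \tr (Q *m H *m invmx P).
Proof.
have sTA : TA^T = TA.
  by have [] := sym_differentiable_is_diff symA (T_diff spdA (spd_det_gt0 spdA)).
have -> : frob TA dA = 2 * \tr (A *m TA *m W).
  have E : frob TA (W *m A)^T = frob TA (W *m A) by rewrite -{1}sTA frob_tr.
  rewrite /dA frob_symE // mulmxDr linearD /= -!(frob_symE _ sTA) E frob_symE //.
  by rewrite -[A *m TA *m W]mulmxA [\tr (A *m _)]mxtrace_mulC -[TA *m W *m A]mulmxA; ring.
have -> : \tr (invmx A *m dA) = 2 * \tr W.
  rewrite /dA mulmxDr linearD /= mxtrace_mulC mulmxK // trmx_mul symA mulKmx //.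
  by rewrite mxtrace_tr; ring.
have -> : Q *m H *m invmx P = A *m TA *m W + (\det A * Ta)%:M *m W.
  by rewrite -mulmxDl -[LHS]mulmxA.
rewrite mxtraceD mul_scalar_mx mxtraceZ.
by rewrite mulrDr; congr (_ + _); ring.
Qed.

Lemma is_diff_Gval_P :
  is_diff P (fun P' => Gval T P' M)
    (fun H => 2 * rho M * \tr (Q *m H *m invmx P)).
Proof.
have sM' : M^T = M by case: sM.
have DA := is_diff_Amx (spd_unitmx sM) (is_diff_id P) (is_diff_const M P).
have DT := is_diff_Tval (B := fun P' => Amx P' M) erefl DA.
have := is_diff_mul (is_diff_const (rho M) P) DT; move/is_diff_ext; apply=> H.
  by rewrite /Gval /Tval symp_id // tr_Amx.
rewrite /= mulr0 addr0 [2 * _]mulrC -mulrA -tr_Qmx; congr (_ * _).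
suff <- : (H *m invmx M + P *m - (invmx M *m 0 *m invmx M)) *m P^T +
    P *m invmx M *m H^T = H *m invmx P *m A + (H *m invmx P *m A)^T by [].
rewrite mulmx0 mul0mx oppr0 mulmx0 addr0 [in RHS]trmx_mul symA.
rewrite [in RHS]trmx_mul /A /Amx !mulmxA mulmxKV //; congr (_ + _).
by rewrite -(mulmxA _ P^T) -trmx_mul mulVmx // trmx1 mulmx1.
Qed.

Lemma differentiable_Gval :
  differentiable (fun p : 'M[R]_d * 'M[R]_d => Gval T p.1 (symp p.2)) (P, M).
Proof.
have sM' : M^T = M by case: sM.
have Ds : is_diff (P, M) (fun p => symp p.2) (fun p => symp p.2).
  exact: is_diff_chain (is_diff_snd _) (is_diff_linear _ (@symp_linear _ _)).
have := is_diff_Amx _ (is_diff_fst (P, M)) Ds.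
rewrite /= symp_id // => /(_ (spd_unitmx sM)) DA.
have DT := is_diff_Tval _ DA.
rewrite /= symp_id // in DT; have {}DT := DT (erefl _).
have DG : differentiable (fun p : 'M[R]_d * 'M[R]_d => rho (symp p.2)) (P, M).
  have Dd := is_diff_differentiable (is_diff_chain Ds (is_diff_det _)).
  apply: (differentiable_comp Dd); apply: differentiable_sqrt.
  by rewrite /= symp_id // spd_det_gt0.
have := differentiableM DG (is_diff_differentiable DT).
rewrite (_ : _ * _ = fun p => Gval T p.1 (symp p.2)) //.
apply: funext => p; rewrite /Gval /Tval -[LHS]/(_ * _).
by rewrite [symp (Amx _ _)]symp_id // tr_Amx // tr_symp.
Qed.

(** The density is differentiable in the pair, so its differential is the sum
    of the two partial ones; that in M is the symmetric derivative. *)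
Lemma is_diff_Gval :
  is_sym_deriv (Gval T P) M (sym_deriv (Gval T P) M) /\
  is_diff (P, M) (fun p => Gval T p.1 (symp p.2))
    (fun h => 2 * rho M * \tr (Q *m h.1 *m invmx P)
              + frob (sym_deriv (Gval T P) M) h.2).
Proof.
have sM' : M^T = M by case: sM.
have D := differentiable_is_diff differentiable_Gval.
have DP := is_diff_chain (is_diff_pair (is_diff_id P) (is_diff_const M P)) D.
have DM := is_diff_chain (is_diff_pair (is_diff_const P M) (is_diff_id M)) D.
have [K DM'] := sym_deriv_is_diff (f := Gval T P) sM' (is_diff_differentiable DM).
split=> //; apply: is_diff_ext D _ _ => // -[h1 h2].
have E : (h1, h2) = (h1, 0) + (0, h2) by congr pair; rewrite /= ?addr0 ?add0r.
rewrite [in LHS]E linearD /=; congr (_ + _).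
  suff DP' : is_diff P (fun B => Gval T B (symp M))
      (fun H => 2 * rho M * \tr (Q *m H *m invmx P)).
    exact: (is_diff_uniq DP DP' h1).
  by apply: is_diff_ext is_diff_Gval_P _ _ => // B; rewrite symp_id.
exact: (is_diff_uniq DM DM' h2).
Qed.

End Density.

(** * Geometry of a simplex *)

Section Geometry.
Variables (R : realType) (d : nat).
Implicit Types (X Xi Y H : 'M[R]_(d.+1, d)) (M N P Q : 'M[R]_d).

Lemma Rmx_row0 k : (Rmx : 'M[R]_(d.+1, d)) ord0 k = -1.
Proof.
(* The rows of the block matrix are indexed by 1 + d, convertible to d.+1. *)
rewrite (_ : ord0 = lshift d (ord0 : 'I_1)); last exact: val_inj.
by rewrite [LHS](@col_mxEu R 1 d d) mxE.
Qed.

Lemma Rmx_rowS l k : (Rmx : 'M[R]_(d.+1, d)) (lift ord0 l) k = (l == k)%:R.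
Proof.
rewrite (_ : lift ord0 l = rshift 1 l); last exact: val_inj.
by rewrite [LHS](@col_mxEd R 1 d d) mxE.
Qed.

Lemma sum_Rmx (F : 'I_d.+1 -> R) k :
  \sum_l F l * Rmx l k = F (lift ord0 k) - F ord0.
Proof.
rewrite big_ord_recl Rmx_row0 mulrN1 addrC; congr (_ - _).
rewrite (bigD1 k) //= Rmx_rowS eqxx mulr1 big1 ?addr0 // => l /negbTE lk.
by rewrite Rmx_rowS lk mulr0.
Qed.

Lemma edge_mxE X : edge_mx X = X^T *m Rmx.
Proof.
apply/matrixP => i k; rewrite [LHS]mxE -(sum_Rmx (X^~ i)) [RHS]mxE.
by apply: eq_bigr => l _; rewrite [X^T _ _]mxE.
Qed.

(** Reads the gradient with respect to the vertices off a trace against the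
    variation of the edges. *)
Lemma tr_edge_mx N H : \tr (N *m edge_mx H) = frob (Rmx *m N) H.
Proof.
rewrite edge_mxE mulmxA mxtrace_mulC mulmxA.
by rewrite /frob -[RHS]mxtrace_tr [in RHS]trmx_mul trmxK [RHS]mxtrace_mulC.
Qed.

Lemma is_diff_edge_mx X : is_diff X (@edge_mx R d) (@edge_mx R d).
Proof.
apply: is_diff_linear => a Y Z.
by rewrite !edge_mxE linearP mulmxDl -scalemxAl.
Qed.

(** Jacobi's formula; the orientation is preserved nearby, so the absolute
    value is the determinant itself. *)
Lemma is_diff_volume X : 0 < \det (edge_mx X) ->
  is_diff X (@volume R d)
    (fun H => volume X * \tr (invmx (edge_mx X) *m edge_mx H)).
Proof.
move=> E0; have uE : edge_mx X \in unitmx by rewrite unitmxE unitfE gt_eqF.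
have Dd := is_diff_chain (is_diff_edge_mx X) (is_diff_det _).
have Dc := is_diff_mul Dd (is_diff_const (d`!%:R^-1 : R) X).
suff D : is_diff X (@volume R d) (fun h => \det (edge_mx X) * 0 +
    d`!%:R^-1 * \tr (\adj (edge_mx X) *m edge_mx h)).
  apply: is_diff_ext D _ _ => // H.
  rewrite mulr0 add0r adj_unitE // -scalemxAl mxtraceZ /volume gtr0_norm //; ring.
apply: (is_diff_near Dc).
have /differentiable_continuous /cvgr_gt := is_diff_differentiable Dd.
move=> /(_ _ E0); apply: filterS => Y Y0.
by rewrite /volume gtr0_norm.
Qed.

Section Pjac.
Variables X Xi : 'M[R]_(d.+1, d).
Hypotheses (uE : edge_mx X \in unitmx) (uEh : edge_mx Xi \in unitmx).

Lemma jac_unitmx : jac X Xi \in unitmx.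
Proof. by rewrite unitmx_mul uE unitmx_inv. Qed.

Lemma pjac_unitmx : pjac X Xi \in unitmx.
Proof. by rewrite unitmx_inv jac_unitmx. Qed.

(** This is dP = - P dJ P with dJ = - J dEhat Ehat^-1. *)
Lemma is_diff_pjac_xi :
  is_diff Xi (pjac X) (fun H => edge_mx H *m invmx (edge_mx Xi) *m pjac X Xi).
Proof.
have Di := is_diff_chain (is_diff_edge_mx Xi) (is_diff_invmx uEh).
have Dj := is_diff_mulmx (is_diff_const (edge_mx X) Xi) Di.
have Dp := is_diff_chain Dj (is_diff_invmx jac_unitmx).
apply: is_diff_ext Dp _ _ => // H.
rewrite mul0mx add0r -/(jac X Xi) -/(pjac X Xi) !mulmxN mulNmx opprK !mulmxA.
congr (_ *m _ *m _); rewrite -[RHS]mul1mx; congr (_ *m _).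
by rewrite -mulmxA -/(jac X Xi) mulVmx // jac_unitmx.
Qed.

Lemma is_diff_pjac_x :
  is_diff X (fun Y => pjac Y Xi)
    (fun H => - (pjac X Xi *m edge_mx H *m invmx (edge_mx Xi) *m pjac X Xi)).
Proof.
have Dj := is_diff_mulmx (is_diff_edge_mx X) (is_diff_const (invmx (edge_mx Xi)) X).
have Dp := is_diff_chain Dj (is_diff_invmx jac_unitmx).
apply: is_diff_ext Dp _ _ => // H.
by rewrite mulmx0 addr0 -/(jac X Xi) -/(pjac X Xi) !mulmxA.
Qed.

End Pjac.

Section Barycentric.
Variables (X : 'M[R]_(d.+1, d)) (phi : 'I_d.+1 -> 'rV[R]_d -> R).
Hypotheses (uE : edge_mx X \in unitmx) (phi_bary : barycentric_basis X phi).

Let V := Rmx *m invmx (edge_mx X).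

(** The gradient of the [j]-th barycentric function is determined by its
    increments along the edges from vertex 0, which form row [j] of [Rmx]. *)
Lemma barycentricE j : exists c, forall y, phi j y = frob (row j V) y + c.
Proof.
have [[g [c E]] Ej] := phi_bary j.
exists c => y; rewrite E; congr (_ + _).
have -> : g = row j V.
  rewrite /V row_mul -[g](mulmxK uE); congr (_ *m _).
  apply/rowP => k; rewrite edge_mxE mulmxA [RHS]mxE [LHS]mxE.
  (* The constant c drops out: the entries of a column of Rmx sum to 0. *)
  rewrite (eq_bigr (fun l => (phi j (row l X) - c) * Rmx l k)); last first.
    move=> l _; rewrite E addrK; congr (_ * _); rewrite !mxE.
    by apply: eq_bigr => i _; rewrite !mxE.
  rewrite sum_Rmx !Ej.
  case: (unliftP ord0 j) => [k' ->|->].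
    rewrite Rmx_rowS (inj_eq lift_inj) [lift _ _ == ord0]eq_sym.
    by rewrite (negbTE (neq_lift _ _)) mulr0n; ring.
  by rewrite Rmx_row0 eqxx (negbTE (neq_lift _ _)) mulr0n mulr1n; ring.
by rewrite frobE big_ord1 mxE; apply: eq_bigr => i _; rewrite [y^T _ _]mxE.
Qed.

Lemma is_diff_barycentric j y : is_diff y (phi j) (frob (row j V)).
Proof.
have [c E] := barycentricE j.
have := is_diff_add (is_diff_linear y (frob_linear (row j V))) (is_diff_const c y).
by move/is_diff_ext; apply => h; rewrite ?addr0 ?E.
Qed.

Lemma grad_barycentric j y : row j V = grad_mx (phi j) y.
Proof. exact/esym/grad_mxE/is_diff_barycentric. Qed.

Variable Mv : 'I_d.+1 -> 'M[R]_d.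

Lemma affine_metric_vertex j : affine_metric phi Mv (row j X) = Mv j.
Proof.
rewrite /affine_metric (bigD1 j) //= (phi_bary j).2 eqxx scale1r big1 ?addr0 //.
by move=> l /negbTE lj; rewrite (phi_bary l).2 lj scale0r.
Qed.

Lemma is_diff_average_metric Y :
  is_diff Y (fun Y => average (fun j => affine_metric phi Mv (row j Y)))
   (fun H => (d.+1%:R)^-1 *: \sum_j \sum_l frob (row l V) (row j H) *: Mv l).
Proof.
have D : is_diff Y (fun Y => \sum_j affine_metric phi Mv (row j Y))
   (fun H => \sum_j \sum_l frob (row l V) (row j H) *: Mv l).
  apply: is_diff_sum => j; apply: is_diff_sum => l; apply: is_diff_scalel.
  have Dr : is_diff Y (@row R d.+1 d j) (@row R d.+1 d j).
    by apply: is_diff_linear => a B C; rewrite linearP.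
  exact: is_diff_chain Dr (is_diff_barycentric l _).
exact: (is_diffZ (d.+1%:R^-1) D).
Qed.

(** A displacement h of one vertex changes the average of the metric by the
    sum over l of <grad phi_l, h> / (d + 1) times [Mv l], whichever vertex it
    is; this is why the gradient has equal rows. *)
Lemma frob_metric_variation (D : 'M[R]_d) H : D^T = D ->
  frob D ((d.+1%:R)^-1 *: \sum_j \sum_l frob (row l V) (row j H) *: Mv l)
  = frob ((d.+1%:R)^-1 *: ((const_mx 1 : 'cV[R]_d.+1)
      *m (\row_j \tr (D *m Mv j)) *m V)) H.
Proof.
move=> sD.
have -> : frob D ((d.+1%:R)^-1 *: \sum_j \sum_l frob (row l V) (row j H) *: Mv l)
  = (d.+1%:R)^-1 * \sum_j \sum_l frob (row l V) (row j H) * \tr (D *m Mv l).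
  rewrite frob_symE // -scalemxAr mxtraceZ mulmx_sumr linear_sum /=; congr (_ * _).
  apply: eq_bigr => j _; rewrite mulmx_sumr linear_sum /=; apply: eq_bigr => l _.
  by rewrite -scalemxAr mxtraceZ.
rewrite [RHS]frobE mulr_sumr; apply: eq_bigr => j _.
under [RHS]eq_bigr => i _ do rewrite mxE -mulrA.
rewrite -mulr_sumr; congr (_ * _).
under [RHS]eq_bigr => i _ do rewrite mxE mulr_suml.
rewrite exchange_big; apply: eq_bigr => l _.
rewrite frobE big_ord1 mulr_suml; apply: eq_bigr => i _.
by rewrite !mxE big_ord1 !mxE; ring.
Qed.

End Barycentric.
End Geometry.

(** * Kernels of one element *)

Section Kernels.
Variables (R : realType) (d : nat) (T : 'M[R]_d -> R -> R).
Hypothesis T_diff : forall (A : 'M[R]_d) (a : R),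
  spd A -> 0 < a -> sym_differentiable T A a.
Variables (X Xi : 'M[R]_(d.+1, d)).
Hypotheses (E_pos : 0 < \det (edge_mx X)) (Eh_pos : 0 < \det (edge_mx Xi)).

Let uE : edge_mx X \in unitmx.
Proof. by rewrite unitmxE unitfE gt_eqF. Qed.

Let uEh : edge_mx Xi \in unitmx.
Proof. by rewrite unitmxE unitfE gt_eqF. Qed.

Let P := pjac X Xi.
Let V := Rmx *m invmx (edge_mx X).

Lemma is_diff_G_of_xi M : spd M ->
  is_diff Xi (G_of_xi T X M)
    (frob ((2 * rho M) *: (Rmx *m invmx (edge_mx Xi) *m Qmx T P M))).
Proof.
move=> sM.
have := is_diff_chain (is_diff_pjac_xi uE uEh)
  (is_diff_Gval_P T_diff (pjac_unitmx uE uEh) sM).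
move/is_diff_ext; apply=> // H; rewrite frobZl; congr (_ * _).
rewrite -!(mulmxA (Qmx _ _ _)) mulmxK ?pjac_unitmx // mulmxA mxtrace_mulC mulmxA.
by rewrite tr_edge_mx mulmxA.
Qed.

Variables (phi : 'I_d.+1 -> 'rV[R]_d -> R) (Mv : 'I_d.+1 -> 'M[R]_d).
Hypotheses (phi_bary : barycentric_basis X phi) (Mv_spd : forall j, spd (Mv j)).

Let M := average Mv.
Let GM := sym_deriv (Gval T P) M.

(** Splits U_K into the volume part and the transport part, using
    V_K J_K = R Ehat^-1. *)
Lemma mulmx_Umx : V *m Umx T X Xi M =
  (- (2^-1 * Tval T P M)) *: V + Rmx *m invmx (edge_mx Xi) *m Qmx T P M *m P.
Proof.
rewrite /Umx -/P mulmxDr mulmxDl mulmxDr; congr (_ + _).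
  rewrite -raddfN mul_mx_scalar -scalemxAl -scalemxAr; congr (_ *: _).
  by rewrite mulmxV ?mulmx1 // jac_unitmx.
by rewrite /V /jac !mulmxA mulmxKV.
Qed.

(** Product rule for |K| G_K: the volume gives |K| G_K V_K, which is what the
    -T/2 term of U_K stands for since G_K = rho T_K; the variation of P gives the
    Q-part of U_K and that of the averaged metric the last summand. *)
Lemma is_diff_volG_of_x :
  is_diff X (volG_of_x T Xi (affine_metric phi Mv))
    (frob (volume X *: (- ((2 * rho M) *: (V *m Umx T X Xi M))
              + (d.+1%:R)^-1 *:
                  ((const_mx 1 : 'cV[R]_d.+1)
                   *m (\row_j \tr (GM *m Mv j)) *m V)))).
Proof.
pose MY Y := average (fun j => affine_metric phi Mv (row j Y)).
have MX : MY X = M.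
  by rewrite /MY /M; congr average; apply: funext => j; apply: affine_metric_vertex.
have symMY Y : (MY Y)^T = MY Y.
  rewrite /MY /average linearZ linear_sum; congr (_ *: _); apply: eq_bigr => j _.
  rewrite /= /affine_metric linear_sum; apply: eq_bigr => l _.
  by rewrite linearZ /=; case: (Mv_spd l) => ->.
have sM : spd M by apply: spd_average.
have [[symGM _] DG] := is_diff_Gval T_diff (pjac_unitmx uE uEh) sM.
have DM := is_diff_average_metric uE phi_bary Mv X.
have Dp := is_diff_pair (is_diff_pjac_x uE uEh) DM.
have := is_diff_chain (g := fun p => Gval T p.1 (symp p.2)) Dp.
rewrite /= -/(MY X) MX => /(_ _ DG) DGY.
have := is_diff_mul (is_diff_volume E_pos) DGY.
move/is_diff_ext; apply=> [Y|H].
  by rewrite /volG_of_x -/(MY Y) symp_id.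
rewrite /= -/(MY X) MX symp_id -?MX // MX.
rewrite (frob_metric_variation _ _ _ symGM) -/P -/GM -/V.
rewrite [RHS]frobZl frobDl frobNl !frobZl mulmx_Umx frobDl frobZl -/V.
have -> : \tr (invmx (edge_mx X) *m edge_mx H) = frob V H by rewrite tr_edge_mx.
have -> : \tr (Qmx T P M *m - (P *m edge_mx H *m invmx (edge_mx Xi) *m P) *m invmx P) =
   - frob (Rmx *m invmx (edge_mx Xi) *m Qmx T P M *m P) H.
  rewrite mulmxN mulNmx raddfN /= mulmxA mulmxK ?pjac_unitmx // !mulmxA.
  by rewrite mxtrace_mulC !mulmxA tr_edge_mx !mulmxA.
by rewrite /Gval; move: (d.+1%:R^-1) => c; field.
Qed.

End Kernels.

(** * Assembly over the mesh *)

Section Assembly.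
Variables (R : realType) (d N : nat) (Th : finType) (vtx : Th -> 'I_d.+1 -> 'I_N).
Hypothesis vtx_inj : forall K, injective (vtx K).

Lemma is_diff_elt_vertices (x : 'M[R]_(N, d)) K :
  is_diff x (fun x => elt_vertices vtx x K) (fun h => elt_vertices vtx h K).
Proof.
apply: is_diff_linear => a y z.
by apply/matrixP => l k; rewrite !mxE.
Qed.

(** An element sees a given node at one local vertex at most, its vertices
    being distinct nodes. *)
Lemma elt_vertices_delta K i k :
  elt_vertices vtx (delta_mx i k : 'M[R]_(N, d)) K =
  if K \in patch vtx i then delta_mx (local_index vtx i K) k else 0.
Proof.
rewrite inE /local_index; apply/matrixP => l b; rewrite mxE.
case: ifP => [/codomP[l0 ->]|iK].
  case: pickP => [l1 /eqP /vtx_inj ->|/(_ l0)]; last by rewrite eqxx.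
  by rewrite !mxE (inj_eq (vtx_inj (K := K))).
rewrite !mxE; case: eqP => //= E; move: iK; rewrite -E.
by rewrite codom_f.
Qed.

(** Chain rule through the restriction of a global vertex array to each
    element; only the elements of the patch see the node. *)
Lemma vertex_deriv_assembly (F : Th -> 'M[R]_(d.+1, d) -> R)
    (B : Th -> 'M[R]_(d.+1, d)) (x : 'M[R]_(N, d)) :
  (forall K, is_diff (elt_vertices vtx x K) (F K) (frob (B K))) ->
  differentiable (fun x => \sum_K F K (elt_vertices vtx x K)) x /\
  forall i, vertex_deriv (fun x => \sum_K F K (elt_vertices vtx x K)) x i =
    \sum_(K in patch vtx i) row (local_index vtx i K) (B K).
Proof.
move=> D.
have DS := is_diff_sum (index_enum Th)
  (fun K => is_diff_chain (is_diff_elt_vertices x K) (D K)).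
split; first exact: is_diff_differentiable DS.
move=> i; rewrite (vertex_derivE i DS); apply/rowP => k.
rewrite summxE [RHS]big_mkcond mxE; apply: eq_bigr => K _.
rewrite elt_vertices_delta; case: ifP => _; first by rewrite frob_delta mxE.
by rewrite /frob mulmx0 mxtrace0.
Qed.

End Assembly.

Theorem proposition4p3 (R : realType) (d : nat) (hd : (2 <= d)%N)
  (N : nat) (Th : finType) (vtx : Th -> 'I_d.+1 -> 'I_N)
  (vtx_inj : forall K, injective (vtx K))
  (x xi : 'M[R]_(N, d))
  (x_pos : positively_oriented vtx x)
  (xi_pos : positively_oriented vtx xi)
  (Mn : 'I_N -> 'M[R]_d) (Mn_spd : forall i, spd (Mn i))
  (phi : Th -> 'I_d.+1 -> 'rV[R]_d -> R)
  (phi_bary : forall K, barycentric_basis (elt_vertices vtx x K) (phi K))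
  (T : 'M[R]_d -> R -> R)
  (T_diff : forall (A : 'M[R]_d) (a : R), spd A -> 0 < a -> sym_differentiable T A a) :
  let X K := elt_vertices vtx x K in
  let Xi K := elt_vertices vtx xi K in
  let Mv K j := Mn (vtx K j) in
  let M K := average (Mv K) in
  let Mh K := affine_metric (phi K) (Mv K) in
  let E K := edge_mx (X K) in
  let Ehat K := edge_mx (Xi K) in
  let P K := pjac (X K) (Xi K) in
  let GM K := sym_deriv (Gval T (P K)) (M K) in
  let V K := Rmx *m invmx (E K) in
  let Gxi K := kernel_xi T (X K) (M K) (Xi K) in
  let Gx K := kernel_x T (Xi K) (Mh K) (X K) in
  [/\ forall K,
        [/\ differentiable (G_of_xi T (X K) (M K)) (Xi K)
          & Gxi K = (2 * rho (M K)) *: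
              (Rmx *m invmx (Ehat K) *m Qmx T (P K) (M K))],
      forall K,
        [/\ forall j y, row j (V K) = grad_mx (phi K j) y,
            is_sym_deriv (Gval T (P K)) (M K) (GM K),
            differentiable (volG_of_x T (Xi K) (Mh K)) (X K),
            Gx K =
              - ((2 * rho (M K)) *: (V K *m Umx T (X K) (Xi K) (M K)))
              + (d.+1%:R)^-1 *:
                  ((const_mx 1 : 'cV[R]_d.+1)
                   *m (\row_j \tr (GM K *m Mv K j)) *m V K)
          & forall j,
              - ((volume (X K))^-1 *:
                   (vertex_deriv (volG_of_x T (Xi K) (Mh K)) (X K) j)^T)
              = (row j (- Gx K))^T],
      differentiable (Ih_of_xi vtx T x M) xi
      /\ forall i, vertex_deriv (Ih_of_xi vtx T x M) xi i =
           \sum_(K in patch vtx i)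
             volume (X K) *: row (local_index vtx i K) (Gxi K)
    & differentiable (Ih_of_x vtx T xi Mh) x
      /\ forall i, vertex_deriv (Ih_of_x vtx T xi Mh) x i =
           \sum_(K in patch vtx i)
             volume (X K) *: row (local_index vtx i K) (Gx K)].
Proof.
move=> X Xi Mv M Mh E Ehat P GM V Gxi Gx.
have uE K : E K \in unitmx by rewrite unitmxE unitfE gt_eqF // x_pos.
have uEh K : Ehat K \in unitmx by rewrite unitmxE unitfE gt_eqF // xi_pos.
have Mv_spd K j : spd (Mv K j) by apply: Mn_spd.
have M_spd K : spd (M K) by apply: spd_average.
have vol0 K : volume (X K) != 0.
  rewrite /volume mulf_neq0 ?invr_eq0 ?pnatr_eq0 -?lt0n ?fact_gt0 //.
  by rewrite normr_eq0 gt_eqF // x_pos.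
have Dxi K := is_diff_G_of_xi T_diff (x_pos K) (xi_pos K) (M_spd K).
have Dx K := is_diff_volG_of_x T_diff (x_pos K) (xi_pos K) (phi_bary K) (Mv_spd K).
have GxiE K : Gxi K = (2 * rho (M K)) *: (Rmx *m invmx (Ehat K) *m Qmx T (P K) (M K)).
  exact: grad_mxE (Dxi K).
have GxE K : volume (X K) *: Gx K = grad_mx (volG_of_x T (Xi K) (Mh K)) (X K).
  by rewrite scalerA mulfV ?scale1r.
split.
- by move=> K; split; [exact: is_diff_differentiable (Dxi K)|exact: GxiE].
- move=> K; split.
  + by move=> j y; apply: (grad_barycentric (uE K) (phi_bary K)).
  + by case: (is_diff_Gval T_diff (pjac_unitmx (uE K) (uEh K)) (M_spd K)).
  + exact: is_diff_differentiable (Dx K).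
  + by rewrite /Gx /kernel_x (grad_mxE (Dx K)) scalerA mulVf ?scale1r.
  + move=> j; have D := differentiable_grad (is_diff_differentiable (Dx K)).
    rewrite (vertex_derivE j D); apply/matrixP => k l.
    by rewrite !mxE frob_delta !mxE.
- have DK : forall K, is_diff (Xi K)
      (fun Y => volume (X K) * G_of_xi T (X K) (M K) Y)
      (frob (volume (X K) *: Gxi K)).
    move=> K; have := is_diff_mul (is_diff_const (volume (X K)) _) (Dxi K).
    move/is_diff_ext; apply=> // H.
    by rewrite mulr0 addr0 [RHS]frobZl GxiE.
  have [D E'] := vertex_deriv_assembly vtx_inj DK.
  split; first exact: D.
  move=> i; rewrite [LHS]E'; apply: eq_bigr => K _.
  by rewrite linearZ.
- have DK : forall K, is_diff (X K) (volG_of_x T (Xi K) (Mh K))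
      (frob (volume (X K) *: Gx K)).
    by move=> K; rewrite GxE; apply: differentiable_grad (is_diff_differentiable (Dx K)).
  have [D E'] := vertex_deriv_assembly vtx_inj DK.
  split; first exact: D.
  move=> i; rewrite [LHS]E'; apply: eq_bigr => K _.
  by rewrite linearZ.
Qed.
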